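(* Let $n$ be a positive integer and let $S=S_1\cup S_2\subseteq T_{8n}\setminus\{e\}$, where $S_1=\langle a^2\rangle\setminus\{e\}$ and $S_2=\langle a\rangle b\cup\langle a\rangle b^3$ (so that $S=S^{-1}$). Then $\mathrm{Cay}(T_{8n},S)$ is a connected integral graph, whose spectrum is $$\mathrm{Spec}(\mathrm{Cay}(T_{8n},S))=\left\{[-3n-1],\,[5n-1],\,[n-1]^6,\,[-1]^{8(n-1)}\right\}.$$
   Context: $T_{8n}=\langle a,b\mid a^{2n}=b^8=e,\ a^n=b^4,\ b^{-1}ab=a^{-1}\rangle$ is a group of order $8n$ with elements $a^rb^s$, $0\le r\le 2n-1$, $0\le s\le 3$. For a finite group $G$ with identity $e$ and a nonempty $S\subseteq G\setminus\{e\}$ with $S=S^{-1}$, $\mathrm{Cay}(G,S)$ is the graph with vertex set $G$ in which $x,y$ are adjacent iff $xy^{-1}\in S$. A graph is integral if all eigenvalues of its adjacency matrix are integers. $\mathrm{Spec}$ is the multiset of adjacency eigenvalues; $[\lambda]^m$ means $\lambda$ occurs with multiplicity $m$ ($m$ omitted if $m=1$). *)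

(* Defs.v *)
From mathcomp Require Import all_boot all_order all_fingroup all_algebra.
From mathcomp Require Import all_field.

Set Implicit Arguments.
Unset Strict Implicit.
Unset Printing Implicit Defensive.

Import GRing.Theory Num.Theory.
Local Open Scope group_scope.

(* gT is the group T_{8n} with distinguished generators a and b. The generators
   in [isog Grp] are existentially quantified, so the relations are repeated
   for a and b: any generating pair satisfying them is the image of the
   canonical one under an automorphism, since gT is finite. *)
Definition is_T8n (n : nat) (gT : finGroupType) (a b : gT) : Prop :=
  [/\ [set: gT] \isog Grp (x : y : x ^+ (2 * n), y ^+ 8,
                                   x ^+ n = y ^+ 4, y^-1 * x * y = x^-1),
      <<[set a; b]>> = [set: gT]
    & [/\ a ^+ (2 * n) = 1, b ^+ 8 = 1,
          a ^+ n = b ^+ 4 & b^-1 * a * b = a^-1]].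

Definition connection_set (gT : finGroupType) (S : {set gT}) : Prop :=
  [/\ S != set0, 1 \notin S & S^-1 = S].

Definition Cay (gT : finGroupType) (S : {set gT}) : rel gT :=
  fun x y => x * y^-1 \in S.

Definition connected_graph (T : finType) (e : rel T) : Prop :=
  forall x y : T, connect e x y.

Definition adjmx (T : finType) (e : rel T) : 'M[algC]_#|T| :=
  \matrix_(i, j) (e (enum_val i) (enum_val j))%:R%R.

Definition integral_graph (T : finType) (e : rel T) : Prop :=
  forall z : algC, eigenvalue (adjmx e) z -> z \in Num.int.

(* Roots of the characteristic polynomial, repeated with multiplicity; a
   multiset, hence meaningful only up to perm_eq. *)
Definition Spec (T : finType) (e : rel T) : seq algC :=
  sval (closed_field_poly_normal (char_poly (adjmx e))).

Definition T8n_S1 (gT : finGroupType) (a : gT) : {set gT} := <[a ^+ 2]> :\ 1.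

Definition T8n_S2 (gT : finGroupType) (a b : gT) : {set gT} :=
  (<[a]> :* b) :|: (<[a]> :* (b ^+ 3)).

(* Main.v *)
(* Write H = <a^2> and K for the index-2 subgroup of the a^r b^s with s even.  Then
   H is contained in K and the connection set is (H \ {e}) together with the
   complement of K, so the adjacency matrix is -1 + P_H - P_K + P_G, where P_L
   is the 0/1 matrix of the relation "x y^-1 lies in L".  For L contained in M,
   P_L P_M = |L| P_M, hence P_L / |L| is an idempotent of rank [G : L] on which
   the partial sums act by scalars, and adding a multiple of such an
   idempotent E to a matrix moves exactly rank E eigenvalues.  Applying this to
   P_H, P_K and P_G in turn gives the spectrum, once |H| = n, |K| = 4n and
   |G| = 8n are known.  The bound |G| >= 8n comes from an explicit regular
   permutation representation. *)

Require Import Defs.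
From mathcomp Require Import all_boot all_order all_fingroup all_algebra.
From mathcomp Require Import all_solvable all_field ring zify.

Set Implicit Arguments.
Unset Strict Implicit.
Unset Printing Implicit Defensive.

Import GRing.Theory Num.Theory GroupScope.
Local Open Scope ring_scope.

(** * Determinants and characteristic polynomials under idempotent perturbations *)

Lemma det_1D_mulmxC (R : comNzRingType) m n (L : 'M[R]_(m, n)) (U : 'M_(n, m)) :
  \det (1%:M + L *m U) = \det (1%:M + U *m L).
Proof.
(* The same block matrix is factored into triangular ones in two ways; comparing determinants gives
   the two sides. *)
have E1 : block_mx 1%:M U (- L) 1%:M
          = block_mx 1%:M 0 (- L) 1%:M *m block_mx 1%:M U 0 (1%:M + L *m U).
  rewrite mulmx_block !mulmx0 !mul0mx ?mulmx1 ?mul1mx !addr0.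
  by rewrite mulNmx addrCA addNr addr0.
have E2 : block_mx 1%:M U (- L) 1%:M
          = block_mx (1%:M + U *m L) U 0 1%:M *m block_mx 1%:M 0 (- L) 1%:M.
  rewrite mulmx_block !mulmx0 !mul0mx ?mulmx1 ?mul1mx ?add0r.
  by rewrite mulmxN addrK.
have /(congr1 determinant) := E1; rewrite {1}E2 !det_mulmx.
by rewrite !det_ublock !det_lblock !det1 !mul1r !mulr1 => ->.
Qed.

Lemma char_poly_scalar (R : comNzRingType) n (c : R) :
  char_poly (c%:M : 'M_n) = ('X - c%:P) ^+ n.
Proof.
by rewrite /char_poly /char_poly_mx map_scalar_mx -raddfB det_scalar.
Qed.

Section Idempotent.

Variables (F : fieldType) (n : nat) (E : 'M[F]_n).
Hypothesis idemE : E *m E = E.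

(** With [E = L *m U], idempotence reads [L U L U = L U]; cancel the full-rank factors on both
    sides. *)
Let base_id : row_base E *m col_base E = 1%:M.
Proof.
move: (mulmx_base E) (row_base_free E) (col_base_full E).
set U := row_base E; set L := col_base E => LU freeU fullL.
apply: (row_free_inj freeU); apply: (row_full_inj fullL).
by rewrite mul1mx -(mulmxA U) mulmxA !LU idemE.
Qed.

Lemma mxtrace_idempotent : \tr E = (\rank E)%:R.
Proof. by rewrite -{1}[E]mulmx_base mxtrace_mulC base_id mxtrace1. Qed.

(** The matrix acts as [p] on the image of [E] and as the identity on its kernel. *)
Lemma det_1D_scale_idempotent (p : {poly F}) :
  \det (1%:M + (p - 1) *: map_mx polyC E) = p ^+ \rank E.
Proof.
rewrite -{1}[E]mulmx_base map_mxM /= scalemxAl det_1D_mulmxC -scalemxAr.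
by rewrite -map_mxM base_id map_mx1 scalemx1 -raddfD subrKC det_scalar.
Qed.

(* Both sides are determinants: ('X - A - t E) (1 + ('X - c - 1) E) equals
   ('X - A) (1 + ('X - c - t - 1) E). *)
Lemma char_poly_addZ_idempotent (A : 'M[F]_n) (c t : F) :
    A *m E = c *: E ->
  char_poly (A + t *: E) * ('X - c%:P) ^+ \rank E
    = char_poly A * ('X - (c + t)%:P) ^+ \rank E.
Proof.
move=> AE.
rewrite /char_poly -!det_1D_scale_idempotent -!det_mulmx; congr (\det _).
rewrite /char_poly_mx map_mxD map_mxZ.
have e1 : map_mx polyC E *m map_mx polyC E = map_mx polyC E.
  by rewrite -map_mxM idemE.
have e2 : map_mx polyC A *m map_mx polyC E = c%:P *: map_mx polyC E.
  by rewrite -map_mxM AE map_mxZ.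
set E' := map_mx _ E in e1 e2 *; set A' := map_mx _ A in e2 *.
rewrite !(mulmxDr, mulmxDl, mulmxN, mulNmx, mulmx1) -!scalemxAr.
rewrite -!scalemxAl e1 e2 mul_scalar_mx !scalerA !opprD -!addrA.
congr (_ + _); congr (_ + _); rewrite -!scaleNr -!scalerDl.
by congr (_ *: _); rewrite /= polyCD; ring.
Qed.

End Idempotent.

(** * Matrices of subgroup coset relations *)

Section CayleySubgroup.

Variable gT : finGroupType.
Implicit Types (L H K : {group gT}) (M : 'M[algC]_#|gT|).

(** Each right coset of [H] lies in one right coset of [K], so the [#|H|] nonzero terms of a row all
    pick the same entry. *)
Lemma mul_adjmx_Cay H K : H \subset K ->
  adjmx (Cay H) *m adjmx (Cay K) = #|H|%:R *: adjmx (Cay K).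
Proof.
move=> sHK; apply/matrixP=> i k; rewrite !mxE.
rewrite (reindex _ (onW_bij _ (enum_rank_bij gT))) /=.
transitivity (
    \sum_(z in H :* enum_val i) (Cay K (enum_val i) (enum_val k))%:R : algC).
  rewrite [RHS]big_mkcond /=; apply: eq_bigr => z _.
  rewrite !mxE enum_rankK /Cay -mem_rcoset rcoset_sym.
  case: (boolP (z \in _)) => Hz; rewrite ?mul0r // mul1r.
  congr (nat_of_bool _)%:R; case/rcosetP: Hz => h Hh ->.
  by rewrite -mulgA groupMl // (subsetP sHK).
by rewrite sumr_const card_rcoset mulr_natl.
Qed.

Lemma mxtrace_adjmx_Cay L : \tr (adjmx (Cay L)) = #|gT|%:R.
Proof.
rewrite -mxtrace1; apply: eq_bigr => i _.
by rewrite !mxE /Cay mulgV group1 eqxx.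
Qed.

Lemma adjmx_Cay1 : adjmx (Cay [1 gT]) = 1%:M.
Proof.
apply/matrixP=> i j; rewrite !mxE /Cay in_set1 -eq_mulgV1.
by rewrite (inj_eq enum_val_inj).
Qed.

Lemma char_poly_addZ_adjmx_Cay M L (c s : algC) :
    M *m adjmx (Cay L) = c *: adjmx (Cay L) ->
  char_poly (M + s *: adjmx (Cay L)) * ('X - c%:P) ^+ #|[set: gT] : L|
    = char_poly M * ('X - (c + s * #|L|%:R)%:P) ^+ #|[set: gT] : L|.
Proof.
move=> ML; set P := adjmx _ in ML *.
have nzL : #|L|%:R != 0 :> algC by rewrite pnatr_eq0 -lt0n cardG_gt0.
pose E := #|L|%:R^-1 *: P.
have idE : E *m E = E.
  by rewrite -scalemxAl -scalemxAr mul_adjmx_Cay // [_^-1 *: (_ *: P)]scalerK.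
have PE : P = #|L|%:R *: E by rewrite scalerKV.
(* In characteristic zero the rank can be read off the trace, here [#|gT| / #|L|]. *)
have rE : \rank E = #|[set: gT] : L|.
  apply/eqP; rewrite -(eqr_nat algC) -mxtrace_idempotent //.
  rewrite mxtraceZ mxtrace_adjmx_Cay -cardsT -(Lagrange (subsetT L)) natrM.
  by rewrite mulKf.
rewrite -rE PE scalerA; apply: char_poly_addZ_idempotent => //.
by rewrite -scalemxAr ML scalerA mulrC -scalerA.
Qed.

(** The coefficients [1] and [-1] are kept explicit to match the shape [M + s *: adjmx (Cay L)]. *)
Lemma adjmx_Cay_cosets H K : H \subset K ->
  adjmx (Cay (H :\ 1%g :|: ~: K))
    = (-1)%:M + 1 *: adjmx (Cay H) + -1 *: adjmx (Cay K)
      + 1 *: adjmx (Cay [set: gT]).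
Proof.
move=> sHK; rewrite -[X in X%:M]mulr1 -scale_scalar_mx -adjmx_Cay1.
apply/matrixP=> i j; rewrite !mxE /Cay !inE /=.
set x := (_ * _)%g; rewrite mulr1 !mul1r.
have := subsetP sHK x; have [->|_] := eqVneq x 1%g.
  by rewrite !group1 /= mulr1 addNr add0r addNr.
case: (x \in H) => [->|_] //=; first by ring.
by case: (x \in K) => /=; ring.
Qed.

End CayleySubgroup.

(** The partial sums act on the next matrix by [-1], [h - 1] and [h - k - 1] in turn. Common factors
    stay uncancelled, which avoids subtracting exponents. *)
Theorem char_poly_Cay_cosets (gT : finGroupType) (H K : {group gT}) :
    H \subset K ->
  let h := #|H|%:R : algC in let k := #|K|%:R in let g := #|gT|%:R in
  let p := char_poly (adjmx (Cay (H :\ 1%g :|: ~: K))) in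
  p * ('X - (h - k - 1)%:P) * ('X - (h - 1)%:P) ^+ #|[set: gT] : K|
      * ('X + 1) ^+ #|[set: gT] : H|
    = ('X + 1) ^+ #|gT| * ('X - (h - 1)%:P) ^+ #|[set: gT] : H|
      * ('X - (h - k - 1)%:P) ^+ #|[set: gT] : K| * ('X - (h - k + g - 1)%:P).
Proof.
move=> sHK h k g p.
have mulJ (L : {group gT}) : adjmx (Cay L) *m adjmx (Cay [set: gT])
    = #|L|%:R *: adjmx (Cay [set: gT]) by apply: mul_adjmx_Cay (subsetT L).
have H1 := @char_poly_addZ_adjmx_Cay gT (-1)%:M H (-1) 1 (mul_scalar_mx _ _).
have /(@char_poly_addZ_adjmx_Cay gT _ K _ (-1)) H2 :
    ((-1)%:M + 1 *: adjmx (Cay H)) *m adjmx (Cay K) = (h - 1) *: adjmx (Cay K).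
  by rewrite mulmxDl mul_scalar_mx scale1r mul_adjmx_Cay // -scalerDl addrC.
have /(@char_poly_addZ_adjmx_Cay gT _ [set: gT]%G _ 1) H3 :
    ((-1)%:M + 1 *: adjmx (Cay H) + -1 *: adjmx (Cay K))
      *m adjmx (Cay [set: gT]) = (h - k - 1) *: adjmx (Cay [set: gT]).
  rewrite !mulmxDl mul_scalar_mx scale1r -scalemxAl !mulJ scalerA -!scalerDl.
  by congr (_ *: _); ring.
rewrite -adjmx_Cay_cosets // indexgg !expr1 cardsT in H3.
rewrite char_poly_scalar in H1.
have e1 : -1 + 1 * #|H|%:R = h - 1 :> algC by rewrite mul1r addrC.
have e2 : h - 1 + -1 * #|K|%:R = h - k - 1 by rewrite mulN1r addrAC.
have e3 : h - k - 1 + 1 * #|gT|%:R = h - k + g - 1 by rewrite mul1r addrAC.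
have e0 : 'X - (-1)%:P = 'X + 1 :> {poly algC} by rewrite polyCN opprK.
rewrite e0 e1 in H1; rewrite e2 in H2; rewrite e3 in H3.
rewrite -/p in H3.
by rewrite H3 (mulrAC (char_poly _)) H2 [LHS]mulrAC (mulrAC (char_poly _)) H1.

Qed.

(** * Connectedness *)

Section Cosets.

Local Open Scope group_scope.

Variables (gT : finGroupType) (H K : {group gT}).
Hypotheses (sHK : H \subset K) (ltK : K \proper [set: gT]).

Let S := H :\ 1 :|: ~: K.

Lemma connection_set_cosets : connection_set S.
Proof.
have [_ [b _ Kb]] := properP ltK.
split; first by apply/set0Pn; exists b; rewrite !inE Kb orbT.
  by rewrite /S in_setU setD11 in_setC group1.
by apply/setP=> x; rewrite !inE invg_eq1 !groupV.
Qed.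

(** Vertices in different cosets of [K] are adjacent; those in the same coset share a neighbour
    [b * x] with [b] outside [K]. *)
Lemma connected_graph_cosets : connected_graph (Cay S).
Proof.
have [_ [b _ Kb]] := properP ltK => x y.
have edge u v : u * v^-1 \notin K -> Cay S u v.
  by move=> Kuv; rewrite /Cay !inE Kuv orbT.
have [Kxy|] := boolP (x * y^-1 \in K); last by move/edge/connect1.
apply: (@connect_trans _ _ (b * x)); apply/connect1/edge.
  by rewrite invMg mulKVg groupV.
by rewrite -mulgA groupMr.
Qed.

End Cosets.

(** * A permutation model and the lower bound on the order *)

Section Model.

Variable n : nat.
Hypothesis n_gt0 : (0 < n)%N.

(* The pair (r, s) stands for a^r b^s; the permutations [x] and [y] below are
   right multiplication by a and b, so that b^4 = a^n causes the wrap-around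
   term in [yf]. *)
Let T := ('Z_(2 * n) * 'Z_4)%type.

Let n2_gt1 : (1 < 2 * n)%N.
Proof. by rewrite mul2n -addnn (leq_add n_gt0 n_gt0). Qed.

Let nD : n%:R + n%:R = 0 :> 'Z_(2 * n).
Proof. by rewrite -natrD addnn -mul2n pchar_Zp. Qed.

(** Moving [a] leftwards across [b ^+ s] inverts it [s] times, whence the sign. *)
Let xf (p : T) : T := (p.1 + (-1) ^+ p.2, p.2).
Let yf (p : T) : T := (p.1 + (p.2 == 3)%:R * n%:R, p.2 + 1).

Let xf_inj : injective xf.
Proof.
move=> [r s] [r' s'] e; have /= es := congr1 snd e.
by have := congr1 fst e; rewrite /= es => /addIr ->.
Qed.

Let yf_inj : injective yf.
Proof.
move=> [r s] [r' s'] e.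
have /= /addIr es := congr1 snd e.
by have := congr1 fst e; rewrite /= es => /addIr ->.
Qed.

Let x := perm xf_inj.
Let y := perm yf_inj.

Let xX k r s : (x ^+ k)%g (r, s) = (r + k%:R * (-1) ^+ s, s) :> T.
Proof.
elim: k => [|k IHk]; first by rewrite expg0 perm1 mul0r addr0.
by rewrite expgSr permM IHk permE /xf /= -addrA -[k.+1]addn1 natrD mulrDl mul1r.
Qed.

(** Four increments in ['Z_4] leave the value 3 exactly once, so the wrap-around term is added
    once. *)
Let y4 (p : T) : (y ^+ 4)%g p = (p.1 + n%:R, p.2).
Proof.
rewrite !expgS expg0 mulg1 !permM !permE /yf /=.
case: p => r [[|[|[|[|//]]]] i] /=;
by congr (_, _); rewrite ?(mul0r, addr0, mul1r) //; apply: val_inj.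
Qed.

Let model_rel : [/\ x ^+ (2 * n) = 1, y ^+ 8 = 1, x ^+ n = y ^+ 4
                  & y^-1 * x * y = x^-1]%g.
Proof.
have xn : (x ^+ n = y ^+ 4)%g.
  apply/permP=> [[r s]]; rewrite xX y4; congr (_ + _, _).
  by rewrite -signr_odd; case: odd; rewrite ?mulr1 // mulrN1 (addr0_eq nD).
have y8 : (y ^+ 8 = 1)%g.
  rewrite (expgM _ 4 2); apply/permP=> p.
  by rewrite expgS expg1 permM !y4 perm1 /= -addrA nD addr0 -surjective_pairing.
split=> //; first by rewrite expgM expgAC xn -expgM.
(* The conjugation relation becomes [x * y * x = y], where the signs attached to [s] and [s + 1]
   cancel. *)
apply: (mulgI y); rewrite !mulgA mulgV mul1g; apply: (mulIg x).
rewrite mulgKV; apply/permP=> [[r s]].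
rewrite !permM !permE /xf /yf /=; congr (_, _).
rewrite (addrAC r) -[RHS]addr0 -[LHS]addrA; congr (_ + _).
case: s => [[|[|[|[|//]]]] i]; rewrite -signr_odd -[X in _ + X]signr_odd /=;
by rewrite ?expr0 ?expr1 ?subrr ?addNr.
Qed.

Let model_transitive (p : T) : exists2 g, g \in <[x]> <*> <[y]> & g (0, 0) = p.
Proof.
have yX s : (s < 4)%N -> (y ^+ s)%g (0, 0) = (0, s%:R).
  case: s => [|[|[|[|//]]]] _; rewrite ?expgS ?expg0 ?mulg1 ?permM ?perm1 //;
  by rewrite !permE /yf /= !mul0r !addr0; congr (_, _); apply: val_inj.
(* The factor [(-1) ^+ s] in the exponent undoes the sign with which [x] acts on second coordinate
   [s]. *)
case: p => r s; exists (y ^+ s * x ^+ (r * (-1) ^+ s)%R)%g.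
  by rewrite groupM // groupX // mem_gen // inE cycle_id ?orbT.
rewrite permM yX // xX !natr_Zp add0r -mulrA -exprMn mulrNN mulr1 expr1n.
by rewrite mulr1.
Qed.

Lemma T8n_card_ge (gT : finGroupType) :
    [set: gT] \isog Grp (x : y : x ^+ (2 * n), y ^+ 8,
                                x ^+ n = y ^+ 4, y^-1 * x * y = x^-1) ->
  (8 * n <= #|[set: gT]|)%N.
Proof.
move=> isoG; have [x2n y8 xn xy] := model_rel.
have homH : <[x]> <*> <[y]> \homg [set: gT].
  rewrite isoG; apply/existsP; exists (x, y).
  by rewrite /= !xpair_eqE x2n y8 xn xy !eqxx.
apply: leq_trans (leq_homg homH).
have <- : #|{: T}| = (8 * n)%N.
  by rewrite card_prod !card_ord !Zp_cast // mulnAC mulnC.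
rewrite -cardsT.
apply: leq_trans (leq_imset_card (fun g : {perm T} => g (0, 0)) _).
apply/subset_leq_card/subsetP=> p _.
by have [g Gg <-] := model_transitive p; apply: imset_f.
Qed.

End Model.

(** * Subgroups of the group and their orders *)

Section Structure.

Local Open Scope group_scope.

Variables (n : nat) (gT : finGroupType) (a b : gT).
Hypotheses (n_gt0 : (0 < n)%N) (T8n_ab : is_T8n n a b).

Lemma T8n_cycle_normal : <[a]> <| [set: gT].
Proof.
have [_ defG [_ _ _ ab]] := T8n_ab.
rewrite /normal subsetT -defG gen_subG subUset !sub1set /=.
rewrite (subsetP (normG _)) ?cycle_id //= inE -cycleJ.
by rewrite conjgE mulgA ab cycleV.
Qed.

Lemma mem_norm_T8n_cycle x : x \in 'N(<[a]>).
Proof. by rewrite (subsetP (normal_norm T8n_cycle_normal)) ?inE. Qed.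

Lemma T8n_quotient : [set: gT] / <[a]> = <[coset <[a]> b]>.
Proof.
have [_ defG _] := T8n_ab.
apply/eqP; rewrite eqEsubset cycle_subG mem_quotient ?inE // andbT.
rewrite sub_quotient_pre ?normal_norm ?T8n_cycle_normal // -defG gen_subG.
rewrite subUset !sub1set /= !morphpreE !in_setI !mem_norm_T8n_cycle !inE /=.
by rewrite cycle_id andbT coset_id ?cycle_id ?group1.
Qed.

(** The relations bound the two orders by [2 * n] and 4, while their product is the group order, at
    least [8 * n]; both bounds are therefore attained. *)
Lemma T8n_orders : #[a] = (2 * n)%N /\ #[coset <[a]> b] = 4.
Proof.
have [isoG _ [a2n b8 anb4 _]] := T8n_ab.
have leG := T8n_card_ge n_gt0 isoG.
have cardG : #|[set: gT]| = (#[a] * #[coset <[a]> b])%N.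
  rewrite -(Lagrange (subsetT <[a]>)) -card_quotient.
    by rewrite T8n_quotient.
  exact: normal_norm T8n_cycle_normal.
have le_a : (#[a] <= 2 * n)%N by rewrite dvdn_leq ?muln_gt0 // order_dvdn a2n.
have le_b : (#[coset <[a]> b] <= 4)%N.
  rewrite dvdn_leq // order_dvdn -morphX ?mem_norm_T8n_cycle // -anb4.
  by rewrite /= coset_id ?mem_cycle.
rewrite cardG in leG.
have:= order_gt0 a; have := order_gt0 (coset <[a]> b).
split; nia.
Qed.

(** As a preimage, membership becomes a parity condition in the cyclic quotient by [<[a]>]. *)
Definition T8n_even : {group gT} :=
  (coset <[a]> @*^-1 <[coset <[a]> b ^+ 2]>)%G.

Lemma T8n_setC_even : T8n_S2 a b = ~: T8n_even.
Proof.
have [_ ob] := T8n_orders.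
have mem_rcosetX x k :
    (x \in <[a]> :* b ^+ k) = (coset <[a]> x == coset <[a]> b ^+ k).
  rewrite -morphX ?mem_norm_T8n_cycle // mem_rcoset eq_mulgV1.
  rewrite -morphV ?mem_norm_T8n_cycle // -morphM ?mem_norm_T8n_cycle //.
  apply/idP/eqP; first exact: coset_id.
  exact/coset_idr/mem_norm_T8n_cycle.
apply/setP=> x; rewrite in_setU in_setC -[X in _ :* X]expg1 !mem_rcosetX.
rewrite /= morphpreE in_setI mem_norm_T8n_cycle inE /=.
have : coset <[a]> x \in <[coset <[a]> b]>.
  by rewrite -T8n_quotient mem_quotient ?inE.
case/cyclePmin=> i; rewrite ob => lt_i4 ->; rewrite !eq_expg_mod_order ob.
have -> : (coset <[a]> b ^+ i \in <[coset <[a]> b ^+ 2]>) = ~~ odd i.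
  apply/cycleP/idP=> [[j /eqP]|even_i].
    by rewrite -expgM eq_expg_mod_order ob; lia.
  by exists i./2; rewrite -expgM; congr (_ ^+ _); lia.
by move: i lt_i4 => [|[|[|[|//]]]].
Qed.

Lemma card_T8n_even : #|T8n_even| = (4 * n)%N.
Proof.
have [oa ob] := T8n_orders.
by rewrite card_cosetpre -!orderE orderXgcd ob oa mulnAC.
Qed.

Lemma card_T8n : #|gT| = (8 * n)%N.
Proof.
have [oa ob] := T8n_orders.
rewrite -cardsT -(Lagrange (subsetT <[a]>)) -card_quotient.
  by rewrite T8n_quotient -!orderE oa ob mulnAC.
exact: normal_norm T8n_cycle_normal.
Qed.

Lemma card_T8n_squares : #|<[a ^+ 2]>| = n.
Proof.
by have [oa _] := T8n_orders; rewrite -orderE orderXdiv oa ?dvdn_mulr // mulKn.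
Qed.

Lemma T8n_squares_sub_even : <[a ^+ 2]> \subset T8n_even.
Proof. by rewrite (subset_trans (cycleX _ _)) // sub_cosetpre. Qed.

End Structure.

(** * Spectrum and integrality from the factored characteristic polynomial *)

Lemma perm_eq_Spec (T : finType) (e : rel T) (s : seq algC) :
  char_poly (adjmx e) = \prod_(z <- s) ('X - z%:P) -> perm_eq (Spec e) s.
Proof.
move=> def_p; apply: prod_XsubC_eq; rewrite -def_p /Spec.
case: closed_field_poly_normal => r /= ->.
by rewrite (monicP (char_poly_monic _)) scale1r.
Qed.

Lemma integral_graph_prod (T : finType) (e : rel T) (s : seq algC) :
    char_poly (adjmx e) = \prod_(z <- s) ('X - z%:P) ->
  {subset s <= Num.int} -> integral_graph e.
Proof.
move=> def_p int_s z; rewrite eigenvalue_root_char def_p root_prod_XsubC.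
exact: int_s.
Qed.

Theorem corollary4p3 (n : nat) (n_gt0 : (0 < n)%N)
    (gT : finGroupType) (a b : gT) (T8n_ab : is_T8n n a b)
    (S : {set gT}) (defS : S = T8n_S1 a :|: T8n_S2 a b) :
  [/\ connection_set S,
      connected_graph (Cay S),
      integral_graph (Cay S)
    & perm_eq (Spec (Cay S))
        ([:: - (3 * n%:R) - 1; 5 * n%:R - 1]
           ++ nseq 6 (n%:R - 1) ++ nseq (8 * (n - 1))%N (- 1))%R].
Proof.
set s := (_ ++ _)%R; set K := T8n_even a b.
have cK : #|K| = (4 * n)%N := card_T8n_even n_gt0 T8n_ab.
have cG := card_T8n n_gt0 T8n_ab.
have cH := card_T8n_squares n_gt0 T8n_ab.
have sHK : <[a ^+ 2]>%g \subset K := T8n_squares_sub_even a b.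
have ltK : K \proper [set: gT].
  by rewrite properEcard subsetT cardsT cK cG ltn_mul2r n_gt0.
have {}defS : S = <[a ^+ 2]>%g :\ 1%g :|: ~: K.
  by rewrite defS (T8n_setC_even n_gt0 T8n_ab).
have iH : #|[set: gT] : <[a ^+ 2]>%g| = 8%N.
  by rewrite -divgS ?subsetT // cardsT cG cH mulnK.
have iK : #|[set: gT] : K| = 2%N.
  by rewrite -divgS ?subsetT // cardsT cG cK divnMr.
have def_p : char_poly (adjmx (Cay S)) = \prod_(z <- s) ('X - z%:P).
  have /= := char_poly_Cay_cosets sHK; rewrite -defS iH iK.
  move: (char_poly _) => p; rewrite cG [#|_|]cH cK !natrM.
  have -> : n%:R - 4 * n%:R - 1 = - (3 * n%:R) - 1 :> algC by ring.
  have -> : n%:R - 4 * n%:R + 8 * n%:R - 1 = 5 * n%:R - 1 :> algC by ring.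
  rewrite /s !big_cat !big_cons big_nil !big_nseq !iter_mulr_1 /= mulr1.
  have X1E : 'X - (-1)%:P = 'X + 1 :> {poly algC} by rewrite polyCN opprK.
  rewrite X1E.
  (* Splits off the exponent 8 that cancels against the index of [<[a ^+ 2]>]; this uses [n_gt0],
     since subtraction is truncated. *)
  have -> : (8 * n = 8 * (n - 1) + 8)%N by lia.
  have nzX (c : algC) : 'X - c%:P != 0 by rewrite polyXsubC_eq0.
  have nz1 : 'X + 1 != 0 :> {poly algC} by rewrite -X1E.
  (* Cancelling the square leaves multiplicity 8 - 2 = 6 for [n - 1]. *)
  move=> eqp; apply: (mulIf (nzX (- (3 * n%:R) - 1))).
  apply: (mulIf (expf_neq0 2 (nzX (n%:R - 1)))).
  apply: (mulIf (expf_neq0 8 nz1)); rewrite {}eqp exprD.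
  (* The linear factors and the power with symbolic exponent become atoms for [ring]. *)
  move: ('X + 1) ('X - (n%:R - 1)%:P) ('X - (5 * n%:R - 1)%:P) => u v z.
  by move: ('X - _) (u ^+ (8 * _)) => w U; ring.
rewrite defS; split.
- exact: connection_set_cosets.
- exact: connected_graph_cosets.
- rewrite -defS; apply: integral_graph_prod def_p _; apply/allP.
  rewrite /s !all_cat !all_nseq /= ?orbT.
  by rewrite !(rpredB, rpredN, rpredM, rpred_nat, rpred1) ?orbT.
- by rewrite -defS; exact: perm_eq_Spec.
Qed.
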